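(* Let $n=2p_1\cdots p_k$, where $k\ge 1$ and $p_1,\ldots,p_k$ are (not necessarily distinct, not necessarily odd) primes. Let $m$ be an odd integer with $1\le m\le n$ and let $b_1,\ldots,b_k$ be integers with $b_i$ coprime to $p_i$ for each $1\le i\le k$. If $k\ge 2$, let $S$ be the sequence in $\mathbb{Z}_n$ $$(b_1,\ p_1b_2,\ p_1p_2b_3,\ \ldots,\ p_1\cdots p_{k-1}b_k,\ \underbrace{n/2,\ldots,n/2}_{m\text{ times}},\ \underbrace{0,\ldots,0}_{n-m\text{ times}}),$$ and if $k=1$ and $p_1=p$, let $S$ be the sequence $$(b_1,\ \underbrace{p,\ldots,p}_{m\text{ times}},\ \underbrace{0,\ldots,0}_{n-m\text{ times}}).$$ Then $S$ is a $U(n)$-extremal sequence for the Gao constant.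
   Context: $\mathbb{Z}_n=\mathbb{Z}/n\mathbb{Z}$ and $U(n)$ is its group of units; integers are identified with their images in $\mathbb{Z}_n$. A sequence is a finite list $(x_1,\ldots,x_l)$ of elements of $\mathbb{Z}_n$ (repetitions allowed); a subsequence is obtained by restricting to a subset of the indices. For $A\subseteq\mathbb{Z}_n$, a subsequence of $(x_1,\ldots,x_l)$ with index set $I$ is an $A$-weighted zero-sum subsequence if $I\ne\emptyset$ and there exist $a_i\in A$ ($i\in I$) with $\sum_{i\in I}a_ix_i=0$. The $A$-weighted Gao constant $E_A(n)$ is the least positive integer $k$ such that every sequence of length $k$ in $\mathbb{Z}_n$ has an $A$-weighted zero-sum subsequence of length $n$. An $A$-extremal sequence for the Gao constant is a sequence in $\mathbb{Z}_n$ of length $E_A(n)-1$ which has no $A$-weighted zero-sum subsequence of length $n$. *)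

(* Defs.v *)
(* MathComp *)
From mathcomp Require Import all_boot all_order all_algebra.

Set Implicit Arguments.
Unset Strict Implicit.
Unset Printing Implicit Defensive.

Import GRing.Theory.
Local Open Scope ring_scope.

(* 'Z_n is Z/nZ only for n >= 2; the definitions below are meant for such n. *)

Definition Zunits (n : nat) : {set 'Z_n} := [set a : 'Z_n | a \is a GRing.unit].

(* Subsequences are index sets, so repeated terms are counted separately. *)
Definition weighted_zero_sum (n : nat) (A : {set 'Z_n}) (x : seq 'Z_n)
    (I : {set 'I_(size x)}) : Prop :=
  I != set0 /\
  exists a : 'I_(size x) -> 'Z_n,
    (forall i, i \in I -> a i \in A) /\ \sum_(i in I) a i * x`_i = 0.

Definition has_zero_sum_of_length (n : nat) (A : {set 'Z_n}) (x : seq 'Z_n)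
    (l : nat) : Prop :=
  exists I : {set 'I_(size x)}, #|I| = l /\ weighted_zero_sum A I.

Definition gao_bound (n : nat) (A : {set 'Z_n}) (l : nat) : Prop :=
  (0 < l)%N /\
  forall x : seq 'Z_n, size x = l -> has_zero_sum_of_length A x n.

(* "E_A(n) = E", as a relation: for some A (e.g. the empty set) no such E
   exists. *)
Definition is_gao_constant (n : nat) (A : {set 'Z_n}) (E : nat) : Prop :=
  gao_bound A E /\ forall l, gao_bound A l -> (E <= l)%N.

Definition gao_extremal (n : nat) (A : {set 'Z_n}) (x : seq 'Z_n) : Prop :=
  exists E : nat,
    [/\ is_gao_constant A E, size x = E.-1 & ~ has_zero_sum_of_length A x n].

(* With indices starting at 0, the i-th of the first k terms is
   p_0 ... p_(i-1) b_i.  When k = 1 and n = 2 p_0, the first term is b_0 and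
   n %/ 2 = p_0, so the case k = 1 needs no separate formula. *)
Definition gao_seq (n k : nat) (p : 'I_k -> nat) (b : 'I_k -> int) (m : nat) :
    seq 'Z_n :=
  [seq ((\prod_(j < k | (j < i)%N) p j)%N%:Z * b i)%:~R | i : 'I_k <- enum 'I_k]
  ++ nseq m (n %/ 2)%N%:R ++ nseq (n - m) 0.

(* Main.v *)
Require Import Defs.
From mathcomp Require Import all_boot all_order all_algebra.
From mathcomp Require Import zify ring.

(* Write r for the number of prime factors of n, counted with multiplicity; the
   Gao constant is n + r when n is even.

   Upper bound. To x in Z_n attach the vector in F_2^r recording, for each prime
   power p^(v+1) dividing n, whether x has p-adic valuation v.  Among n + r terms
   one can delete exactly r so that the remaining n vectors sum to 0: a smallest
   set of terms with the same sum and the same parity as the whole sequence has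
   at most r elements, and it can be enlarged by pairs of equal terms until it has
   r elements.  In the remaining subsequence every valuation below the exponent
   of p in n occurs an even number of times, so the terms can be paired off to
   cancel modulo that power of p, with weights prime to p; the weights for the
   various p are glued by the Chinese remainder theorem.

   Lower bound. Let i be the first of the k special terms used in a relation of
   length n.  Multiplying by n / (p_0 ... p_i) kills every other term, but not
   this one.  Hence all n other terms are used; units are odd, so the relation
   reads m * (n/2) = 0, which is false for odd m. *)

Set Implicit Arguments.
Unset Strict Implicit.
Unset Printing Implicit Defensive.

Import GRing.Theory.

(** * Weighted sums of natural numbers with weights coprime to the modulus *)

Definition coprime_zero_sum (I : finType) (K : {set I}) (f : I -> nat)
    (m : nat) : Prop :=
  exists2 u : I -> nat, forall i, coprime m (u i) & m %| \sum_(i in K) u i * f i.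

(** Induction on [#|K|]: a term of valuation [v < a] has a partner of the same valuation, and the
    two can be made to cancel. Once no such term is left, [p ^ a] divides every term and all weights
    can be 1. *)
Lemma coprime_zero_sum_prime_power (I : finType) (p a : nat) (K : {set I})
    (f : I -> nat) :
  prime p -> (forall i, 0 < f i) ->
  (forall v, v < a -> ~~ odd #|[set i in K | logn p (f i) == v]|) ->
  coprime_zero_sum K f (p ^ a).
Proof.
move=> p_pr f_gt0; have [N] := ubnP #|K|.
elim: N K => // N IH K ltK evK.
have [/existsP[i /andP[iK lti]] | /existsPn noK] :=
    boolP [exists i, (i \in K) && (logn p (f i) < a)]; last first.
  exists (fun=> 1) => [i|]; first by rewrite coprimen1.
  apply: dvdn_sum => i iK; rewrite mul1n pfactor_dvdn // leqNgt.
  by have := noK i; rewrite iK.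
set v := logn p (f i) in lti.
have [j /andP[jK neqji] eqv] : exists2 j, (j \in K) && (j != i) & logn p (f j) = v.
  have := evK _ lti; rewrite (cardsD1 i) inE iK eqxx oddD /= => /negPn.
  case: (set_0Vmem ([set i in K | logn p (f i) == v] :\ i)) => [->|[j]].
    by rewrite cards0.
  by rewrite !inE => /and3P[neq jK /eqP eqv] _; exists j => //; rewrite jK.
have iKj : i \in K :\ j by rewrite !inE eq_sym neqji.
have cardK : #|K| = #|K :\ j :\ i|.+2 by rewrite (cardsD1 j) jK (cardsD1 i) iKj.
have [|v' ltv'|u u_co u_sum] := IH (K :\ j :\ i); first by rewrite cardK in ltK; lia.
  have [->|neqv] := eqVneq v' v; last first.
    rewrite (_ : [set _ in _ | _] = [set i in K | logn p (f i) == v']) ?evK //.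
    apply/setP => l; rewrite !inE.
    have [->|_] := eqVneq l i; first by rewrite -/v [v == v']eq_sym (negPf neqv) !andbF.
    by have [->|//] := eqVneq l j; rewrite eqv [v == v']eq_sym (negPf neqv) !andbF.
  have := evK _ lti.
  rewrite (cardsD1 i) inE iK eqxx /= (cardsD1 j) !inE neqji jK eqv eqxx /= negbK.
  congr (~~ odd _); apply: eq_card => l; rewrite !inE.
  by case: (l \in K); rewrite ?andbF ?andbT //= andbA [(_ != i) && _]andbC.
have [gi gi_co fiE] := pfactor_coprime p_pr (f_gt0 i).
have [gj gj_co fjE] := pfactor_coprime p_pr (f_gt0 j).
have pa_gt0 : 0 < p ^ a by rewrite expn_gt0 prime_gt0.
(* Here [(p ^ a).-1] plays the role of -1 modulo [p ^ a]: the pair contributes [gi * gj * p ^ v]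
   times [1 + (p ^ a).-1 = p ^ a]. *)
exists (fun l => if l == i then gj else if l == j then gi * (p ^ a).-1 else u l).
  move=> l; case: eqP => _; first by rewrite coprimeXl.
  case: eqP => _; last exact: u_co.
  by rewrite coprimeMr coprimeXl //= coprimenP.
rewrite (big_setD1 j) //= (big_setD1 i) //= eqxx (negPf neqji) eqxx addnA dvdn_add //.
  rewrite fiE fjE eqv -/v; apply/dvdnP; exists (gi * gj * p ^ v).
  by case: (p ^ a) pa_gt0 => // q _ /=; ring.
under eq_bigr => l do [rewrite !inE => /and3P[/negPf -> /negPf -> _]].
exact: u_sum.
Qed.

Lemma coprime_zero_sumM (I : finType) (K : {set I}) (f : I -> nat) (m1 m2 : nat) :
  coprime m1 m2 -> coprime_zero_sum K f m1 -> coprime_zero_sum K f m2 ->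
  coprime_zero_sum K f (m1 * m2).
Proof.
move=> co12 [u1 u1_co u1_sum] [u2 u2_co u2_sum].
pose u i := chinese m1 m2 (u1 i) (u2 i).
have u_sum (v : I -> nat) m : (forall i, u i = v i %[mod m]) ->
    (m %| \sum_(i in K) u i * f i) = (m %| \sum_(i in K) v i * f i).
  move=> eq_uv; rewrite /dvdn -modn_summ -[in RHS]modn_summ.
  by under eq_bigr => i _ do rewrite -modnMml eq_uv modnMml.
exists u => [i|].
  rewrite coprimeMl -coprime_modr chinese_modl // coprime_modr u1_co /=.
  by rewrite -coprime_modr chinese_modr // coprime_modr.
rewrite Gauss_dvd //; apply/andP; split.
  by rewrite (u_sum u1) // => i; apply: chinese_modl.
by rewrite (u_sum u2) // => i; apply: chinese_modr.
Qed.

Lemma coprime_zero_sum_of_prime_powers (I : finType) (K : {set I}) (f : I -> nat) (n : nat) :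
  0 < n -> (forall p, prime p -> coprime_zero_sum K f (p ^ logn p n)) ->
  coprime_zero_sum K f n.
Proof.
elim/ltn_ind: n => n IH n_gt0 Hp.
have [n1|n_gt1] := leqP n 1.
  by rewrite (_ : n = 1); [exists (fun=> 1) | lia].
have p_pr := pdiv_prime n_gt1; set p := pdiv n in p_pr.
rewrite -(partnC p n_gt0); apply: coprime_zero_sumM.
- exact: coprime_partC.
- by rewrite p_part; apply: Hp.
apply: IH; rewrite ?part_gt0 //.
  rewrite -[X in _ < X](partnC p n_gt0) ltn_Pmull ?part_gt0 // p_part.
  by rewrite -[1]/(p ^ 0) ltn_exp2l ?prime_gt1 // logn_gt0 mem_primes p_pr n_gt0 pdiv_dvd.
(* The cofactor has [p]-exponent 0, so its modulus at [p] is 1; at other primes it has the same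
   exponent as [n]. *)
move=> q q_pr; have [->|neq] := eqVneq q p.
  rewrite logn_coprime; first by exists (fun=> 1).
  by rewrite prime_coprime // -p'natE // part_pnat.
have := Hp q q_pr; rewrite -{1}(partnC p n_gt0) lognM ?part_gt0 //.
by rewrite p_part lognX (logn_prime q p_pr) (negPf neq) muln0.
Qed.

(** For prime entries, each one is paired with the number of its later occurrences, so a prime
    occurring [e] times gets the levels [0, ..., e - 1]. This gives exactly one parity condition per
    prime factor. *)
Fixpoint valuation_levels (qs : seq nat) : seq (nat * nat) :=
  if qs is q :: qs' then (q, logn q (\prod_(q' <- qs') q')) :: valuation_levels qs'
  else [::].

Lemma size_valuation_levels qs : size (valuation_levels qs) = size qs.
Proof. by elim: qs => //= q qs ->. Qed.

Lemma mem_valuation_levels (qs : seq nat) (p v : nat) :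
  all prime qs -> v < logn p (\prod_(q <- qs) q) -> (p, v) \in valuation_levels qs.
Proof.
elim: qs => [|q qs IH] /=; first by rewrite big_nil logn1.
case/andP=> q_pr qs_pr; have prod_gt0 : 0 < \prod_(q' <- qs) q'.
  by rewrite big_seq prodn_cond_gt0 // => q' /(allP qs_pr)/prime_gt0.
rewrite big_cons inE (lognM _ (prime_gt0 q_pr) prod_gt0).
rewrite logn_prime // xpair_eqE; case: eqVneq => [<-|_] /=; last by rewrite add0n; apply: IH.
by rewrite add1n ltnS leq_eqVlt => /orP[->//|/IH ->]; rewrite ?orbT.
Qed.

Local Open Scope ring_scope.

(** * Zero sums of prescribed length over the field with two elements *)

Lemma addrr_rV_F2 r (v : 'rV['F_2]_r) : v + v = 0.
Proof.
by apply/rowP => j; rewrite !mxE -mulr2n -mulr_natr pchar_Zp ?mulr0.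
Qed.

(** Pigeonhole: [D] has more than [2 ^ r.+1] subsets, the number of possible pairs (sum, parity of
    the size). The symmetric difference of two subsets with the same pair is the required set. *)
Lemma exists_zero_sum_sub_F2 (I : finType) r (w : I -> 'rV['F_2]_r)
    (D : {set I}) : (r.+1 < #|D|)%N ->
  exists E : {set I}, [/\ E \subset D, E != set0, ~~ odd #|E|
    & \sum_(i in E) w i = 0].
Proof.
move=> ltrD.
pose V : finType := ('rV['F_2]_r * bool)%type.
pose f (A : {set I}) : V := (\sum_(i in A) w i, odd #|A|).
have /dinjectivePn[A] : ~~ dinjectiveb f (mem (powerset D)).
  apply/negP => /dinjectiveP/card_in_image f_inj.
  have := max_card (mem (image f (mem (powerset D)))).
  rewrite f_inj card_prod card_mx card_ord card_bool card_powerset mul1n.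
  by rewrite -[X in (_ <= _ * X)%N]/(2 ^ 1)%N -expnD leq_exp2l // addn1 leqNgt ltrD.
rewrite inE => sAD [B]; rewrite !inE => /andP[neqBA sBD] [eqw eqodd].
exists ((A :\: B) :|: (B :\: A)).
have dis : (A :\: B) :&: (B :\: A) = set0.
  by apply/setP => i; rewrite !inE; case: (i \in A); case: (i \in B).
have dis' : [disjoint A :\: B & B :\: A] by rewrite -setI_eq0 dis.
split.
- by rewrite subUset !(subset_trans (subsetDl _ _)).
- apply: contraNneq neqBA => /setP eq0; apply/eqP/setP => i.
  by have := eq0 i; rewrite !inE; case: (i \in A); case: (i \in B).
- rewrite cardsU dis cards0 subn0 oddD.
  move: eqodd; rewrite -(cardsID B A) -(cardsID A B) setIC !oddD.
  by move=> /addbI ->; rewrite addbb.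
rewrite (eq_bigl [predU A :\: B & B :\: A]); last by move=> i; rewrite in_setU.
rewrite bigU //=.
move: eqw; rewrite (big_setID B) [RHS](big_setID A) /= setIC => /addrI ->.
exact: addrr_rV_F2.
Qed.

Lemma zero_sum_of_even_length_F2 (N n r : nat) (T : finType)
    (w : T -> 'rV['F_2]_r) (x : 'I_N -> T) :
  ~~ odd n -> (#|T| <= n)%N -> N = (n + r)%N ->
  exists K : {set 'I_N}, #|K| = n /\ \sum_(i in K) w (x i) = 0.
Proof.
move=> n_even leTn eqN.
pose P (D : {set 'I_N}) :=
  (\sum_(i in D) w (x i) == \sum_i w (x i)) && (odd #|D| == odd r).
have oddN : odd N = odd r by rewrite eqN oddD (negPf n_even).
have PT : P setT.
  rewrite /P cardsT card_ord oddN eqxx andbT.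
  by apply/eqP/eq_bigl => i; rewrite inE.
have [D0 PD0 leD0] : exists2 D, P D & (#|D| <= r)%N.
  case: (arg_minnP (fun D : {set 'I_N} => #|D|) PT) => D PD minD.
  exists D => //; case/andP: PD => /eqP sumD /eqP parD.
  (* Size [r.+1] has the wrong parity; beyond it, removing an even zero-sum subset would contradict
     minimality. *)
  suff leD : (#|D| <= r.+1)%N.
    by rewrite -ltnS ltn_neqAle leD andbT; apply: contra_eq_neq parD => -> /=; case: odd.
  rewrite leqNgt; apply/negP => /(exists_zero_sum_sub_F2 (w \o x)).
  case=> E [sED E0 evE sumE].
  have cardDE : (#|D| = #|E| + #|D :\: E|)%N by rewrite -(cardsID E D) (setIidPr sED).
  have /minD : P (D :\: E).
    rewrite /P -sumD [X in _ == X](big_setID E) /= (setIidPr sED) sumE add0r eqxx /=.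
    by rewrite -parD cardDE oddD (negPf evE).
  by rewrite leqNgt cardDE -{1}[#|D :\: E|]add0n ltn_add2r card_gt0 E0.
pose Q D := P D && (#|D| <= r)%N.
have QD0 : Q D0 by rewrite /Q PD0.
case: (arg_maxnP (fun D : {set 'I_N} => #|D|) QD0) => D /andP[PD leD] maxD.
have cardC : (#|D| + #|~: D| = n + r)%N by rewrite cardsC card_ord.
case/andP: PD => /eqP sumD /eqP parD.
have eqD : #|D| = r.
  apply/eqP; apply: contraT => neqD.
  have ltD : (#|D| + 2 <= r)%N by lia.
  (* At least [n + 2] indices lie outside [D], more than [T] has values. Adding two with equal
     values changes neither the sum nor the parity. *)
  have /dinjectivePn[i] : ~~ dinjectiveb x (mem (~: D)).
    apply/negP => /dinjectiveP/card_in_image x_inj.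
    have : (#|~: D| <= #|T|)%N by rewrite -[X in (X <= _)%N]x_inj max_card.
    lia.
  rewrite inE => iD [j /andP[neqji jD] eqx].
  move: jD; rewrite inE => jD.
  have ijD : i \notin j |: D by rewrite !inE negb_or eq_sym neqji.
  have /maxD : Q (i |: (j |: D)).
    rewrite /Q /P !cardsU1 ijD jD !big_setU1 //= eqx addrA addrr_rV_F2 add0r sumD eqxx.
    by rewrite /= negbK parD eqxx /= addnA addnC.
  by rewrite !cardsU1 ijD jD; lia.
exists (~: D); split; first by lia.
apply: (addrI (\sum_(i in D) w (x i))); rewrite addr0 [RHS]sumD.
rewrite [RHS](bigID (mem D)) /=; congr (_ + _).
by apply: eq_bigl => i; rewrite inE.
Qed.

(** * Upper bound for the Gao constant *)

Lemma Zp_natr_eq0 (n a : nat) : (1 < n)%N -> (a%:R == 0 :> 'Z_n) = (n %| a)%N.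
Proof. by move=> n_gt1; rewrite -val_eqE /= val_Zp_nat. Qed.

Lemma Zp_intr_eq0 (n : nat) (z : int) :
  (1 < n)%N -> (z%:~R == 0 :> 'Z_n) = (n%:Z %| z)%Z.
Proof.
move=> n_gt1; case: z => a; first by rewrite dvdzE -Zp_natr_eq0.
by rewrite NegzE mulrNz oppr_eq0 dvdzE abszN -Zp_natr_eq0.
Qed.

Lemma gao_bound_Zunits (n : nat) (qs : seq nat) :
  (1 < n)%N -> ~~ odd n -> all prime qs -> n = (\prod_(q <- qs) q)%N ->
  gao_bound (Zunits n) (n + size qs).
Proof.
move=> n_gt1 n_even qs_pr eqn; split; first by lia.
move=> x size_x.
(* A zero term is represented by n, so that all representatives have the right valuations. *)
pose rep (t : 'Z_n) : nat := if t == 0 then n else t.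
have rep_gt0 t : (0 < rep t)%N.
  rewrite /rep; case: eqVneq => [_|t0]; first by lia.
  by rewrite lt0n; apply: contraNneq t0 => t0; apply/eqP/val_inj.
have repK t : (rep t)%:R = t.
  rewrite /rep; case: eqVneq => [->|_]; last exact: natr_Zp.
  by apply/eqP; rewrite Zp_natr_eq0.
pose lev := tnth (in_tuple (valuation_levels qs)).
pose w (t : 'Z_n) : 'rV['F_2]_(size (valuation_levels qs)) :=
  \row_j (logn (lev j).1 (rep t) == (lev j).2)%:R.
have [||K [cardK sumK]] := @zero_sum_of_even_length_F2 (size x) n _ _ w
  (fun i => x`_i) n_even _ _.
- by rewrite card_ord Zp_cast.
- by rewrite size_valuation_levels.
pose f (i : 'I_(size x)) := rep x`_i.
have [||u u_co u_sum] := @coprime_zero_sum_of_prime_powers _ K f n.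
- by lia.
- move=> p p_pr; apply: coprime_zero_sum_prime_power => // [i|v]; first exact: rep_gt0.
  rewrite {1}eqn => /(mem_valuation_levels qs_pr) /(tnthP (in_tuple _)) [j levj].
  (* Coordinate [j] of the zero sum counts, modulo 2, the chosen terms of [p]-adic valuation [v]. *)
  have /rowP/(_ j) := sumK.
  rewrite summxE !mxE; under eq_bigr do rewrite mxE /lev -levj /=.
  rewrite -natr_sum => /eqP; rewrite Zp_natr_eq0 // dvdn2.
  congr (~~ odd _); rewrite -sum1_card big_mkcond [RHS]big_mkcond /=.
  apply: eq_bigr => i _; rewrite inE; case: (i \in K) => //=.
exists K; split=> //; split; first by rewrite -card_gt0 cardK; lia.
exists (fun i => (u i)%:R); split=> [i _|]; first by rewrite inE unitZpE.
apply/eqP; rewrite -(Zp_natr_eq0 _ n_gt1) natr_sum in u_sum.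
by under eq_bigr do rewrite -[x`__]repK -natrM.
Qed.

(** * Lower bound from the explicit sequence *)

Lemma has_zero_sum_of_length_cat (n : nat) (A : {set 'Z_n}) (x y : seq 'Z_n)
    (l : nat) :
  has_zero_sum_of_length A x l -> has_zero_sum_of_length A (x ++ y) l.
Proof.
case=> I [cardI [I0 [a [aA suma]]]].
have le_xy : (size x <= size (x ++ y))%N by rewrite size_cat leq_addr.
have w_inj : injective (widen_ord le_xy) by move=> i j /(congr1 val) /= /val_inj.
exists (widen_ord le_xy @: I); split; first by rewrite card_imset.
split.
  by have [i iI] := set0Pn _ I0; apply/set0Pn; exists (widen_ord le_xy i); apply: imset_f.
(* The default weight 0 falls only on positions in [y], outside the image of [I], so it need not lie
   in [A]. *)
exists (fun j => if insub (val j) is Some i then a i else 0).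
have valKa (i : 'I_(size x)) : insub (val (widen_ord le_xy i)) = Some i by exact: valK.
split=> [_ /imsetP[i iI ->]|]; first by rewrite valKa; apply: aA.
rewrite big_imset /=; last by move=> i j _ _; apply: w_inj.
by rewrite -[RHS]suma; apply: eq_bigr => i _; rewrite valK nth_cat ltn_ord.
Qed.

Section GaoSeq.

Variables (n k m : nat) (p : 'I_k -> nat) (b : 'I_k -> int).

Lemma size_gao_seq : (m <= n)%N -> size (gao_seq n p b m) = (k + n)%N.
Proof.
by move=> le_mn; rewrite !size_cat size_map size_enum_ord !size_nseq subnKC.
Qed.

Lemma nth_gao_seq_head (i : 'I_k) :
  (gao_seq n p b m)`_i = ((\prod_(j < k | (j < i)%N) p j)%N%:Z * b i)%:~R.
Proof.
by rewrite nth_cat size_map size_enum_ord ltn_ord (nth_map i) ?size_enum_ord // nth_ord_enum.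
Qed.

Lemma nth_gao_seq_tail (i : nat) :
  (k <= i)%N -> (gao_seq n p b m)`_i = if (i < k + m)%N then (n %/ 2)%N%:R else 0.
Proof.
move=> le_ki; rewrite nth_cat size_map size_enum_ord ltnNge le_ki /= nth_cat size_nseq.
have -> : (i - k < m)%N = (i < k + m)%N by rewrite ltn_subLR.
by case: ifP => [lt_im|_]; rewrite nth_nseq; [rewrite ltn_subLR // lt_im | rewrite if_same].
Qed.

Lemma gao_seq_not_zero_sum :
  (forall i, prime (p i)) -> n = (2 * \prod_(i < k) p i)%N -> odd m ->
  (m <= n)%N -> (forall i, coprimez (b i) (Posz (p i))) ->
  ~ has_zero_sum_of_length (Zunits n) (gao_seq n p b m) n.
Proof.
move=> p_pr eqn m_odd le_mn b_co [I [cardI [I0 [a [aU suma]]]]].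
have prod_gt0 : (0 < \prod_(i < k) p i)%N by apply: prodn_gt0 => i; apply: prime_gt0.
have n_gt1 : (1 < n)%N by lia.
have n2E : (n %/ 2 = \prod_(i < k) p i)%N by rewrite eqn mulKn.
have size_S := size_gao_seq le_mn.
have I_tail (i : 'I_(size (gao_seq n p b m))) : i \in I -> (k <= i)%N.
  move=> iI; rewrite leqNgt; apply/negP => lt_ik.
  have Qi : (i \in I) && (i < k)%N by rewrite iI.
  case: (arg_minnP (P := fun i => (i \in I) && (i < k)%N) val Qi) => {lt_ik iI Qi} {}i.
  case/andP=> iI lt_ik i_min.
  pose i' := Ordinal lt_ik.
  pose P := (\prod_(j < k | (j <= i)%N) p j)%N.
  have PE : P = (p i' * \prod_(j < k | (j < i)%N) p j)%N.
    rewrite /P (bigD1 i') //=; congr (_ * _)%N; apply: eq_bigl => j.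
    by rewrite ltn_neqAle andbC.
  have dvdP_prod : (P %| \prod_(j < k) p j)%N.
    by rewrite [X in (_ %| X)%N](bigID (fun j : 'I_k => (j <= i)%N)) dvdn_mulr.
  (* The multiplier [c] is [n / (p_0 ... p_i)]. It kills [n/2] because [P] divides [n/2], and the
     later special terms because [P] divides their prefix products. *)
  have [c eqc] : exists c, n = (c * P)%N by apply/dvdnP; rewrite eqn dvdn_mull.
  have c_gt0 : (0 < c)%N by lia.
  have kill l : l \in I -> l != i -> c%:R * (gao_seq n p b m)`_l = 0.
    move=> lI neqli; have [le_kl | lt_lk] := leqP k l.
      rewrite nth_gao_seq_tail //; case: ifP => _; last by rewrite mulr0.
      by rewrite -natrM; apply/eqP; rewrite Zp_natr_eq0 // n2E {1}eqc dvdn_mul.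
    have lt_il : (i < l)%N.
      by rewrite ltn_neqAle i_min ?lI // andbT eq_sym; apply: neqli.
    rewrite (nth_gao_seq_head (Ordinal lt_lk)) pmulrn -intrM mulrA.
    apply/eqP; rewrite Zp_intr_eq0 // dvdz_mulr // -PoszM dvdzE /= {1}eqc.
    apply: dvdn_mul => //.
    rewrite [X in (_ %| X)%N](bigID (fun j : 'I_k => (j <= i)%N)) /=.
    apply: dvdn_mulr; rewrite (eq_bigl (fun j : 'I_k => (j <= i)%N)) // => j /=.
    by apply/idP/idP => [/andP[]//|le_ji]; rewrite le_ji (leq_ltn_trans le_ji).
  have /eqP : c%:R * (gao_seq n p b m)`_i = 0.
    have := congr1 ( *%R c%:R) suma.
    rewrite mulr0 big_distrr /= (big_setD1 i) //= big1 ?addr0.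
      move: (aU i iI); rewrite inE => ai_unit.
      by rewrite mulrCA -[X in _ = X](mulr0 (a i)) => /(mulrI ai_unit).
    by move=> l; rewrite !inE => /andP[neqli lI]; rewrite mulrCA kill ?mulr0.
  (* After cancelling [c] and [p_0 ... p_(i-1)], the surviving term would force [p_i] to divide
     [b_i]. *)
  rewrite (nth_gao_seq_head i') pmulrn -intrM mulrA Zp_intr_eq0 // eqc PE.
  rewrite !dvdzE !abszM /= -mulnA [(p i' * _)%N]mulnC !mulnA dvdn_pmul2l; last first.
    rewrite muln_gt0 c_gt0; apply: prodn_cond_gt0 => j _; exact: prime_gt0.
  apply/negP; rewrite -prime_coprime //.
  by have := b_co i'; rewrite coprimezE coprime_sym.
have IE : I = [set i : 'I_(size (gao_seq n p b m)) | (k <= i)%N].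
  set J := [set i | _].
  apply/eqP; rewrite eqEcard cardI; apply/andP; split.
    by apply/subsetP => i /I_tail; rewrite inE.
  (* The complement of [J] contains the [k] head positions, so [J] has at most [n] elements and the
     inclusion of [I] in [J] is an equality. *)
  have cardJ : (#|J| + #|~: J| = k + n)%N by rewrite cardsC card_ord.
  rewrite -(leq_add2r #|~: J|) cardJ addnC leq_add2l.
  have le_kS : (k <= size (gao_seq n p b m))%N by rewrite size_S leq_addr.
  have {1}<- : #|widen_ord le_kS @: [set: 'I_k]| = k.
    by rewrite card_imset ?cardsT ?card_ord // => i j /(congr1 val) /= /val_inj.
  apply: subset_leq_card; apply/subsetP => _ /imsetP[i _ ->].
  by rewrite !inE -ltnNge /=.
(* Units of Z_n are odd, so they act trivially on multiples of n/2. *)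
have unit_half i : i \in I -> a i * (n %/ 2)%N%:R = (n %/ 2)%N%:R.
  move=> iI; move: (aU i iI); rewrite inE -[a i]natr_Zp unitZpE // => co.
  have ai_odd : odd (a i).
    by rewrite -coprime2n; apply: coprime_dvdl co; rewrite [X in (_ %| X)%N]eqn dvdn_mulr.
  rewrite -natrM -[nat_of_ord (a i)](odd_double_half (a i)) ai_odd -muln2 mulnDl mul1n.
  rewrite natrD -mulnA n2E -eqn natrM.
  by rewrite [n%:R](_ : _ = 0) ?mulr0 ?addr0 //; apply/eqP; rewrite Zp_natr_eq0.
have : \sum_(k <= i < k + n) (if (i < k + m)%N then (n %/ 2)%N%:R else 0) = 0 :> 'Z_n.
  rewrite -size_S -[RHS]suma big_geq_mkord /= IE.
  apply: eq_big => [i|i /= le_ki]; first by rewrite inE.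
  rewrite nth_gao_seq_tail //; case: ifP => _; last by rewrite mulr0.
  by rewrite unit_half // IE inE.
rewrite (big_cat_nat (n := (k + m)%N)) ?leq_addr ?leq_add2l //=.
rewrite big_nat [X in _ + X]big_nat.
under eq_bigr => i /andP[_ ->] do [].
rewrite [X in _ + X]big1; last by move=> i /andP[le_i _]; rewrite ltnNge le_i.
rewrite addr0 -big_nat sumr_const_nat addKn -mulrnA.
(* Divisibility of [m * (n/2)] by [n = 2 * (n/2)] amounts to [m] being even. *)
apply/eqP; rewrite Zp_natr_eq0 // n2E {1}eqn [(2 * _)%N]mulnC dvdn_pmul2l //.
by rewrite dvdn2 m_odd.
Qed.

End GaoSeq.

Theorem lemma4 (n k m : nat) (p : 'I_k -> nat) (b : 'I_k -> int)
    (hk : (1 <= k)%N)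
    (hp : forall i : 'I_k, prime (p i))
    (hn : n = (2 * \prod_(i < k) p i)%N)
    (hm_odd : odd m)
    (hm : (1 <= m <= n)%N)
    (hb : forall i : 'I_k, coprimez (b i) (Posz (p i))) :
  gao_extremal (Zunits n) (gao_seq n p b m).
Proof.
have /andP[_ le_mn] := hm.
have prod_gt0 : (0 < \prod_(i < k) p i)%N by apply: prodn_gt0 => i; apply: prime_gt0.
have not_zs := gao_seq_not_zero_sum hp hn hm_odd le_mn hb.
have size_S := size_gao_seq p b le_mn.
have bound : gao_bound (Zunits n) (n + k.+1).
  (* The explicit factor 2 is the extra prime that makes the count [k.+1]. *)
  pose qs := (2 :: [seq p i | i <- enum 'I_k])%N.
  have -> : k.+1 = size qs by rewrite /= size_map size_enum_ord.
  apply: gao_bound_Zunits; first by lia.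
  - by rewrite hn oddM.
  - by apply/andP; split=> //; apply/allP => _ /mapP[i _ ->].
  - by rewrite big_cons big_map big_enum.
exists (n + k.+1)%N; split=> //; last by rewrite size_S addnS addnC.
(* If some [l <= n + k] were a bound, the prefix of length [l] of the sequence would contain a zero
   sum of length [n], hence so would the whole sequence. *)
split=> // l [_ bound_l]; rewrite addnS ltnNge; apply/negP => le_l; apply: not_zs.
rewrite -(cat_take_drop l (gao_seq n p b m)); apply/has_zero_sum_of_length_cat/bound_l.
by apply: size_takel; rewrite size_S addnC.
Qed.
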